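(* Assume that the Boolean algebra $\mathcal{P}(\mathbb{N})$ is $(\aleph_1,\aleph_0)$-ideal and that $\mathfrak{m}_c>\aleph_1$. Then for every point $u$ of $\mathbb{N}^*=\beta\mathbb{N}\setminus\mathbb{N}$ the subspace $\mathbb{N}^*\setminus\{u\}$ is $C^*$-embedded in $\mathbb{N}^*$, i.e., every bounded continuous real-valued function on $\mathbb{N}^*\setminus\{u\}$ extends continuously to $\mathbb{N}^*$.
   Context: A subalgebra $A$ of a Boolean algebra $B$ is \emph{$\aleph_0$-ideal} if for each $b\in B\setminus A$ the ideal $\{a\in A: a<b\}$ of $A$ has a countable cofinal subset. A Boolean algebra $B$ is \emph{$(\aleph_1,\aleph_0)$-ideal} if there is a family $\mathcal{A}$ of $\aleph_0$-ideal subalgebras of $B$, each of cardinality $\aleph_1$, such that every subset of $B$ of size $\aleph_1$ is contained in some member of $\mathcal{A}$ and the union of each chain from $\mathcal{A}$ of cofinality $\omega_1$ is again in $\mathcal{A}$. For subsets $S,T$ of a Boolean algebra, $S\perp T$ means $s\wedge t=0$ for all $s\in S$, $t\in T$. A subset $A$ of a Boolean algebra $B$ is \emph{$\aleph_0$-ideal complete} if for any two countable (possibly finite or empty) subsets $S,T$ of $A$ with $S\perp T$, and such that $1$ is not the join of a finite subset of $S\cup T$, there is $b\in B\setminus A$ such that $\{a\in A:a\le b\}$ is generated by $S$ and $\{a\in A: a\wedge b=0\}$ is generated by $T$; this means that $s\le b$ for all $s\in S$, $t\wedge b=0$ for all $t\in T$, every $a\in A$ with $a\le b$ lies below a finite join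 of elements of $S$, and every $a\in A$ with $a\wedge b=0$ lies below a finite join of elements of $T$. $\mathfrak{m}_c(B)$ is the minimum cardinality of a subset of $B$ that is not $\aleph_0$-ideal complete, and $\mathfrak{m}_c=\mathfrak{m}_c(\mathcal{P}(\mathbb{N})/\mathrm{fin})$. *)

(* Defs.v *)
From HB Require Import structures.
From mathcomp Require Import all_boot all_order all_algebra generic_quotient.
From mathcomp Require Import all_classical all_reals all_analysis.

Set Implicit Arguments.
Unset Strict Implicit.
Unset Printing Implicit Defensive.

Import Order.TTheory.
Import numFieldNormedType.Exports.

Local Open Scope classical_set_scope.
Local Open Scope card_scope.

(* Cardinals are handled relationally, through [#<=]: [A] has cardinality
   aleph_1 when its cardinal is the least uncountable one. *)
Definition has_card_aleph1 (T : Type) (A : set T) : Prop :=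
  ~ countable A /\ forall (U : Type) (C : set U), ~ countable C -> A #<= C.

Definition card_gt_aleph1 (T : Type) (A : set T) : Prop :=
  exists2 K : set T, has_card_aleph1 K & (K #<= A) && ~~ (A #<= K).

Definition cofinal_in (T : Type) (le : T -> T -> Prop) (C D : set T) : Prop :=
  D `<=` C /\ forall c, C c -> exists2 d, D d & le c d.

(* The cofinality of a linearly ordered [C] is the least cardinality of a
   cofinal subset; here it is aleph_1. *)
Definition cofinality_omega1 (T : Type) (le : T -> T -> Prop) (C : set T) :
    Prop :=
  exists D : set T, [/\ cofinal_in le C D, has_card_aleph1 D
    & forall E : set T, cofinal_in le C E -> D #<= E].

Section BooleanAlgebra.
Context {disp : Order.disp_t} (B : ctbDistrLatticeType disp).
Implicit Types (A S T : set B) (a b : B).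

Definition is_subalgebra A : Prop :=
  [/\ A \bot%O, A \top%O,
      (forall x y, A x -> A y -> A (x `&` y)%O),
      (forall x y, A x -> A y -> A (x `|` y)%O)
    & (forall x, A x -> A (~` x)%O)].

Definition aleph0_ideal A : Prop :=
  is_subalgebra A /\
  forall b, ~ A b ->
    exists2 D : set B, countable D &
      cofinal_in (fun x y => (x <= y)%O) [set a | A a /\ (a < b)%O] D.

Definition aleph1_aleph0_ideal : Prop :=
  exists F : set (set B),
    [/\ (forall A, F A -> aleph0_ideal A /\ has_card_aleph1 A),
        (forall X : set B, has_card_aleph1 X -> exists2 A, F A & X `<=` A)
      & (forall C : set (set B), C `<=` F -> total_on C subset ->
           cofinality_omega1 subset C -> F (\bigcup_(A in C) A))].

(* [b] is the join of a finite subset of [S]; finite subsets are listed by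
   sequences, and the empty join is [\bot]. *)
Definition finite_join_of S b : Prop :=
  exists2 s : seq B, [set` s] `<=` S & b = (\join_(x <- s) x)%O.

Definition ideal_generated_by (I S : set B) : Prop :=
  S `<=` I /\
  forall a, I a -> exists2 c, finite_join_of S c & (a <= c)%O.

Definition aleph0_ideal_complete A : Prop :=
  forall S T, S `<=` A -> T `<=` A -> countable S -> countable T ->
    (forall s t, S s -> T t -> (s `&` t)%O = \bot%O) ->
    ~ finite_join_of (S `|` T) \top%O ->
    exists b, [/\ ~ A b,
      ideal_generated_by [set a | A a /\ (a <= b)%O] S
    & ideal_generated_by [set a | A a /\ (a `&` b)%O = \bot%O] T].

(* The cardinal m_c(B), a minimum of cardinals, is represented by a set [M] at
   which it is attained. *)
Definition is_mc (M : set B) : Prop :=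
  ~ aleph0_ideal_complete M /\
  forall A, ~ aleph0_ideal_complete A -> M #<= A.

Definition mc_gt_aleph1 : Prop :=
  exists2 M : set B, is_mc M & card_gt_aleph1 M.

End BooleanAlgebra.

Section AlmostInclusion.

Definition almost_sub (A B : set nat) : bool := `[< finite_set (A `\` B) >].

Definition almost_eq (A B : set nat) : bool :=
  almost_sub A B && almost_sub B A.

Lemma almost_subW A B : A `<=` B -> almost_sub A B.
Proof. by rewrite -setD_eq0 => AB; apply/asboolP; rewrite AB; exact: finite_set0. Qed.

Lemma almost_sub_refl : reflexive almost_sub.
Proof. by move=> A; exact: almost_subW. Qed.

Lemma almost_sub_trans : transitive almost_sub.
Proof.
move=> B A C /asboolP AB /asboolP BC; apply/asboolP.
have : finite_set ((A `\` B) `|` (B `\` C)) by rewrite finite_setU.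
apply: sub_finite_set => x [Ax nCx].
by have [Bx|nBx] := pselect (B x); [right|left].
Qed.

Lemma almost_sub_setI A B C :
  almost_sub A (B `&` C) = almost_sub A B && almost_sub A C.
Proof.
apply/idP/andP => [ABC|[/asboolP AB /asboolP AC]].
  by split; apply: almost_sub_trans ABC _; apply: almost_subW => x [].
by apply/asboolP; rewrite setDIr finite_setU.
Qed.

Lemma almost_sub_setU A B C :
  almost_sub (A `|` B) C = almost_sub A C && almost_sub B C.
Proof.
apply/idP/andP => [ABC|[/asboolP AC /asboolP BC]].
  by split; apply: almost_sub_trans ABC; apply: almost_subW => x; [left|right].
by apply/asboolP; rewrite setDUl finite_setU.
Qed.

Lemma almost_eq_refl : reflexive almost_eq.
Proof. by move=> A; rewrite /almost_eq almost_sub_refl. Qed.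

Lemma almost_eq_sym : symmetric almost_eq.
Proof. by move=> A B; rewrite /almost_eq andbC. Qed.

Lemma almost_eq_trans : transitive almost_eq.
Proof.
move=> B A C /andP[AB BA] /andP[BC CB].
by rewrite /almost_eq (almost_sub_trans AB BC) (almost_sub_trans CB BA).
Qed.

Canonical almost_eq_equiv : equiv_rel (set nat) :=
  EquivRel almost_eq almost_eq_refl almost_eq_sym almost_eq_trans.

End AlmostInclusion.

Local Open Scope quotient_scope.

Definition PN_fin : Type := {eq_quot almost_eq}.

HB.instance Definition _ := Choice.on PN_fin.
HB.instance Definition _ := EqQuotient.on PN_fin.

Section PNFinBoolean.

Definition fin_class (A : set nat) : PN_fin := \pi_PN_fin A.

Let rep (x : PN_fin) : set nat := repr x.

Let rep_class A : almost_eq (rep (fin_class A)) A.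
Proof. by rewrite -eqmodE reprK. Qed.

Let repK x : fin_class (rep x) = x.
Proof. exact: reprK. Qed.

Let le_fin (x y : PN_fin) : bool := almost_sub (rep x) (rep y).

Let le_class A C : le_fin (fin_class A) (fin_class C) = almost_sub A C.
Proof.
have /andP[A1 A2] := rep_class A; have /andP[C1 C2] := rep_class C.
apply/idP/idP => [AC|AC].
  exact: almost_sub_trans A2 (almost_sub_trans AC C1).
exact: almost_sub_trans A1 (almost_sub_trans AC C2).
Qed.

Let meet_fin (x y : PN_fin) : PN_fin := fin_class (rep x `&` rep y).
Let join_fin (x y : PN_fin) : PN_fin := fin_class (rep x `|` rep y).
Let diff_fin (x y : PN_fin) : PN_fin := fin_class (rep x `\` rep y).

Let le_refl : reflexive le_fin.
Proof. by move=> x; exact: almost_sub_refl. Qed.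

Let le_anti : antisymmetric le_fin.
Proof.
move=> x y xy; rewrite -(repK x) -(repK y); apply/eqP.
by rewrite /fin_class eqmodE.
Qed.

Let le_trans : transitive le_fin.
Proof. by move=> y x z; exact: almost_sub_trans. Qed.

HB.instance Definition _ :=
  Order.Le_isPOrder.Build set_display PN_fin le_refl le_anti le_trans.

Let meetP x y z : le_fin x (meet_fin y z) = le_fin x y && le_fin x z.
Proof. by rewrite -{1}(repK x) le_class almost_sub_setI. Qed.

Let joinP x y z : le_fin (join_fin x y) z = le_fin x z && le_fin y z.
Proof. by rewrite -{1}(repK z) le_class almost_sub_setU. Qed.

HB.instance Definition _ :=
  Order.POrder_MeetJoin_isLattice.Build set_display PN_fin meetP joinP.

Lemma fin_class_le A C :
  (fin_class A <= fin_class C)%O = `[< finite_set (A `\` C) >].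
Proof. exact: le_class. Qed.

Lemma fin_class_meet A C :
  (fin_class A `&` fin_class C)%O = fin_class (A `&` C).
Proof.
have /andP[A1 A2] := rep_class A; have /andP[C1 C2] := rep_class C.
apply/eqP; rewrite /fin_class eqmodE; apply/andP; split.
  rewrite almost_sub_setI; apply/andP; split.
    by apply: almost_sub_trans A1; apply: almost_subW => x [].
  by apply: almost_sub_trans C1; apply: almost_subW => x [].
rewrite almost_sub_setI; apply/andP; split.
  by apply: almost_sub_trans A2; apply: almost_subW => x [].
by apply: almost_sub_trans C2; apply: almost_subW => x [].
Qed.

Lemma fin_class_join A C :
  (fin_class A `|` fin_class C)%O = fin_class (A `|` C).
Proof.
have /andP[A1 A2] := rep_class A; have /andP[C1 C2] := rep_class C.
apply/eqP; rewrite /fin_class eqmodE; apply/andP; split.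
  rewrite almost_sub_setU; apply/andP; split.
    by apply: (almost_sub_trans A1); apply: almost_subW => x; left.
  by apply: (almost_sub_trans C1); apply: almost_subW => x; right.
rewrite almost_sub_setU; apply/andP; split.
  by apply: (almost_sub_trans A2); apply: almost_subW => x; left.
by apply: (almost_sub_trans C2); apply: almost_subW => x; right.
Qed.

Let meetUl : @left_distributive PN_fin PN_fin Order.meet Order.join.
Proof.
move=> x y z; rewrite -(repK x) -(repK y) -(repK z).
by rewrite !(fin_class_meet, fin_class_join) setIUl.
Qed.

HB.instance Definition _ :=
  Order.Lattice_Meet_isDistrLattice.Build set_display PN_fin meetUl.

Let bot_le x : (fin_class set0 <= x)%O.
Proof. by rewrite -(repK x) fin_class_le; apply/asboolP; rewrite set0D. Qed.

Let le_top x : (x <= fin_class setT)%O.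
Proof. by rewrite -(repK x) fin_class_le; apply/asboolP; rewrite setDT. Qed.

HB.instance Definition _ := Order.hasBottom.Build set_display PN_fin bot_le.
HB.instance Definition _ := Order.hasTop.Build set_display PN_fin le_top.

Let diffKI (x y : PN_fin) : (y `&` diff_fin x y)%O = \bot%O.
Proof.
rewrite -{1}(repK y) fin_class_meet.
by rewrite (_ : rep y `&` _ = set0) //; apply/seteqP; split=> n // [? []].
Qed.

Let joinIB (x y : PN_fin) : ((x `&` y) `|` diff_fin x y)%O = x.
Proof.
rewrite -{1}(repK x) -{1}(repK y) fin_class_meet fin_class_join.
by rewrite setUIDK repK.
Qed.

HB.instance Definition _ :=
  Order.BDistrLattice_hasSectionalComplement.Build set_display PN_fin
    diffKI joinIB.

Let compl_fin (x : PN_fin) : PN_fin := ((\top : PN_fin) `\` x)%O.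

Let compl_finE (x : PN_fin) : compl_fin x = ((\top : PN_fin) `\` x)%O.
Proof. by []. Qed.

HB.instance Definition _ :=
  Order.CBDistrLattice_hasComplement.Build set_display PN_fin compl_finE.

End PNFinBoolean.

(* The Stone-Cech compactification of a discrete space [T] is the space of
   ultrafilters on [T]; the sets of ultrafilters containing a given subset of
   [T] form a base of its topology. *)
Record beta (T : Type) := Beta {
  beta_filter :> set_system T;
  beta_ultra : UltraFilter beta_filter }.

HB.instance Definition _ (T : Type) := gen_eqMixin (beta T).
HB.instance Definition _ (T : Type) := gen_choiceMixin (beta T).

Section BetaTopology.
Variable T : Type.

Definition beta_basic (A : set T) : set (beta T) :=
  [set p : beta T | beta_filter p A].

Let beta_cover : \bigcup_(A in @setT (set T)) beta_basic A = setT.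
Proof.
apply/seteqP; split=> // p _; exists setT => //.
by have pU := beta_ultra p; exact: (@filterT _ (beta_filter p)).
Qed.

Let beta_join (A C : set T) (p : beta T) : setT A -> setT C ->
  beta_basic A p -> beta_basic C p ->
  exists D, [/\ setT D, beta_basic D p
    & beta_basic D `<=` beta_basic A `&` beta_basic C].
Proof.
move=> _ _ pA pC; exists (A `&` C); split => //.
  by have pU := beta_ultra p; exact: (@filterI _ (beta_filter p)).
move=> q qAC; have qU := beta_ultra q.
by split; apply: (@filterS _ (beta_filter q) _ _ _ _ qAC) => x [].
Qed.

HB.instance Definition _ :=
  isBaseTopological.Build (beta T) beta_cover beta_join.

End BetaTopology.

Definition beta_point (T : Type) (x : T) : beta T :=
  Beta (principal_filter_ultra x).

Definition Nstar : set (beta nat) := ~` range (@beta_point nat).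

(* Real functions on a subspace [A] of [X] are represented by functions on [X],
   whose values outside [A] are irrelevant. *)
Definition Cstar_embedded (R : realType) (X : topologicalType) (A Y : set X) :
    Prop :=
  A `<=` Y /\
  forall f : X -> R, [bounded f x | x in A] -> {within A, continuous f} ->
    exists2 g : X -> R, {within Y, continuous g} & {in A, f =1 g}.

(* Main.v *)
Require Import Defs.
From mathcomp Require Import all_boot all_order all_algebra.
From mathcomp Require Import all_classical all_reals all_analysis.
From mathcomp Require Import wochoice lra.

Set Implicit Arguments.
Unset Strict Implicit.
Unset Printing Implicit Defensive.

Import Order.TTheory GRing.Theory Num.Theory.
Import numFieldNormedType.Exports.

Local Open Scope classical_set_scope.
Local Open Scope card_scope.

(** For a set a of natural numbers, a* denotes the set of points of Nstar
    that contain a; the sets a* form a clopen base of Nstar. Let f be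
    bounded and continuous on Nstar minus u. If f does not extend to u, then
    it oscillates at u: there are p < q such that f takes values < p and
    values > q in every neighbourhood of u ([limit_at_removed_point],
    [extension_of_limit]). The claim is that this is impossible
    ([no_oscillation]).

    For a set P of reals, call the set a a P-piece when u is not in a* and f
    maps a* into P. Since Nstar is zero-dimensional, every a outside u is
    the union of a (< s)-piece and a (> r)-piece when r < s ([piece_split]).
    Fix p < r < s < q, and close off to obtain an aleph_0-ideal subalgebra A
    of cardinality aleph_1 that is the union of a chain of length omega_1
    and reflects all this ([closing_off]): members of A outside u split into
    such pieces inside A, and every member of A in u contains infinite (<
    p)- and (> q)-pieces that are in A.

    As A has size aleph_1 < m_c, some b meets all infinite members of A in
    an infinite set, and b can be taken outside u because b may be replaced
    by its complement ([splitting_family]). Write b as the union of a (<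
    q)-piece b0 and a (> s)-piece b1. Every (< s)-piece in A is almost
    disjoint from b1, and as A is aleph_0-ideal each member of A almost
    disjoint from b1 is contained in one of countably many such members c_n.
    No c_n is in u: otherwise c_n would contain an infinite (> q)-piece in
    A, which is almost disjoint from b0 and from b1, hence from b
    ([piece_countable_cover]). The symmetric argument puts each (> r)-piece
    in A inside one of countably many members d_m of A outside u. So the
    complements of the sets c_n `|` d_m are a countable subset of A that
    generates the trace of u on A.

    This contradicts the way in which A was built: every countable part of A
    is contained in a stage X of the chain, and A contains a member of u
    whose complement meets every infinite member of X in an infinite set.
    That member of u includes no infinite member of X, so no countable part
    of A generates the trace of u. *)

(** * Sets of cardinality at most aleph_1 *)

(** The order type omega_1. Transitivity is a consequence: well-foundedness
    excludes cycles, so it follows from trichotomy. *)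
Record omega1_order (I : Type) (lt : I -> I -> Prop) : Prop := Omega1Order {
  omega1_wf : well_founded lt;
  omega1_total : forall x y, [\/ lt x y, x = y | lt y x];
  omega1_segment : forall x, countable [set y | lt y x];
  omega1_uncountable : ~ countable [set: I] }.

Lemma inj_card_le_im (T U : Type) (A : set T) (B : set U) (f : T -> U) :
  {in A &, injective f} -> (forall x, A x -> B (f x)) -> A #<= B.
Proof.
move=> finj fAB; have /card_eqPle[_ h] := inj_card_eq finj.
by apply: card_le_trans h _; apply: subset_card_le => _ [x Ax <-]; exact: fAB.
Qed.

Lemma has_card_aleph1_image (T U : Type) (f : T -> U) (K : set T) :
  {in K &, injective f} -> has_card_aleph1 K -> has_card_aleph1 (f @` K).
Proof.
move=> finj [Kunc Kmin]; have fK := inj_card_eq finj; split.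
  by rewrite (eq_countable fK).
by move=> V C Cunc; rewrite (card_le_eql fK); exact: Kmin.
Qed.

(** Well-order the ambient type and keep the members of K that have countably
    many predecessors in K. *)
Lemma omega1_order_exists (T : Type) (K : set T) : has_card_aleph1 K ->
  exists (I : pointedType) (lt : I -> I -> Prop),
    omega1_order lt /\ has_card_aleph1 [set: I].
Proof.
elim/Pchoice: T K => T K [Kunc Kmin].
have [R Rwo] := well_ordering_principle T.
have Ranti : antisymmetric R.
  have Rch : wo_chain R predT by move=> A _; exact: Rwo.
  by move=> x y; exact: (wo_chain_antisymmetric Rch).
have minR (A : set T) : A !=set0 -> exists2 z, A z & forall x, A x -> R z x.
  move=> [x Ax]; have [|z [[zA zmin] _]] := Rwo [pred x | `[< A x >]].
    by exists x; apply/asboolP.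
  exists z; first exact/asboolP.
  by move=> y Ay; apply: zmin; apply/asboolP.
have Rtot x y : R x y \/ R y x.
  have [|z [->|->] zm] := minR [set x; y]; first by exists x; left.
  - by left; apply: zm; right.
  - by right; apply: zm; left.
pose lt (x y : T) := R x y /\ x <> y.
have lttot x y : [\/ lt x y, x = y | lt y x].
  have [->|xy] := pselect (x = y); first exact: Or32.
  have [Rxy|Ryx] := Rtot x y; first by apply: Or31.
  by apply: Or33; split=> // yx; exact/xy.
pose W := [set x | K x /\ countable [set y | K y /\ lt y x]].
have WK : W `<=` K by move=> x [].
have Wunc : ~ countable W.
  (* Otherwise the least element of K outside W has all its predecessors in
     K inside W, hence lies in W. *)
  move=> Wc; have [KW|nKW] := pselect (K `<=` W).
    by apply: Kunc; apply: sub_countable Wc; exact: subset_card_le.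
  have [|z [Kz nWz] zm] := minR (K `\` W).
    by move/existsNP: nKW => [x /not_implyP[Kx nWx]]; exists x.
  apply: nWz; split=> //; apply: sub_countable Wc; apply: subset_card_le.
  move=> y [Ky [Ryz yz]]; apply: contrapT => nWy; apply: yz.
  by apply: Ranti; rewrite Ryz zm.
pose L (x y : W) := lt (val x) (val y).
suff [HL HW] : omega1_order L /\ has_card_aleph1 [set: W].
  have : exists (I : Type) (lt : I -> I -> Prop),
    omega1_order lt /\ has_card_aleph1 [set: I] by exists W, L.
  case=> I; elim/Ppointed: I => I; last by move=> [l H]; exists I, l.
  move=> [l [[_ _ _ unc] _]]; exfalso; apply: unc.
  by rewrite (_ : setT = set0) //; apply/seteqP; split=> x //; case: (no x).
have WT : [set: W] #= W by exact: card_setT.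
have /card_eqPle[WT1 WT2] := WT.
have uncW : ~ countable [set: W] by rewrite (eq_countable WT).
split; last first.
  split=> // U C Cunc; apply: card_le_trans WT1 _.
  by apply: card_le_trans (Kmin _ _ Cunc); exact: subset_card_le.
split; last exact: uncW.
- move=> x; apply: contrapT => nx.
  have [|z [w wz nw] zm] := minR [set z | exists2 w : W, val w = z & ~ Acc L w].
    by exists (val x), x.
  apply: nw; constructor => y; rewrite /L wz => -[Ryz yz].
  apply: contrapT => ny; apply: yz; apply: Ranti; rewrite Ryz zm//.
  by exists y.
- move=> x y; case: (lttot (val x) (val y)) => [h|h|h].
  + exact: Or31.
  + by apply: Or32; exact: val_inj.
  + exact: Or33.
- move=> x; have /set_mem[Kx cx] := valP x.
  apply: sub_countable cx; apply: (@inj_card_le_im _ _ _ _ val).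
    by move=> a b _ _; exact: val_inj.
  by move=> a /= ax; split=> //; apply: WK; exact: set_mem (valP a).
Qed.

(** Recursion along a well-founded relation, in the form where each value
    depends only on the set of the earlier values. *)
Lemma wf_rec_image (I V : Type) (lt : I -> I -> Prop) (G : set V -> V) :
  well_founded lt ->
  exists h : I -> V, forall x, h x = G (h @` [set y | lt y x]).
Proof.
move=> wf.
pose F (x : I) (rec : forall y, lt y x -> V) : V :=
  G [set v | exists y (H : lt y x), rec y H = v].
exists (Fix wf (fun=> V) F) => x; rewrite Fix_eq.
  congr G; apply/seteqP; split=> v.
    by move=> [y [H <-]]; exists y.
  by move=> [y H <-]; exists y, H.
move=> {}x f g fg; congr G; apply/seteqP; split=> v [y [H <-]]; exists y, H;
  by rewrite fg.
Qed.

Lemma countable_setU (T : Type) (A B : set T) :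
  countable A -> countable B -> countable (A `|` B).
Proof.
move=> cA cB; rewrite -bigcup2inE.
by apply: bigcup_countable => // -[|[|]] /=.
Qed.

Lemma omega1_bounded (I : Type) (lt : I -> I -> Prop) (E : set I) :
  omega1_order lt -> countable E -> exists z, forall x, E x -> lt x z.
Proof.
move=> [_ tot seg unc] Ec; apply: contrapT => nz; apply: unc.
apply: (@sub_countable _ _ _ (\bigcup_(x in E) ([set y | lt y x] `|` [set x]))).
  apply: subset_card_le => z _; apply: contrapT => nzE; apply: nz.
  exists z => x Ex.
  by case: (tot x z) => // h; case: nzE; exists x => //=; [right|left].
by apply: bigcup_countable => // x _; apply: countable_setU.
Qed.

(** A union of omega_1 many countable sets has size at most aleph_1. This is
    aleph_1 * aleph_0 = aleph_1: recursion on omega_1 yields injections h x from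
    nat to I with pairwise disjoint ranges, because the ranges chosen before
    stage x cover only a countable set. *)
Lemma card_le_countable_bigcup (I : pointedType) (lt : I -> I -> Prop)
    (U : Type) (G : I -> set U) :
  omega1_order lt -> (forall x, countable (G x)) ->
  \bigcup_x G x #<= [set: I].
Proof.
move=> W Gc.
have fresh (S : set (nat -> I)) : exists g : nat -> I, countable S ->
    injective g /\ forall n s m, S s -> g n <> s m.
  have [Sc|] := pselect (countable S); last by exists (fun=> point).
  pose D := ~` (\bigcup_(s in S) range s).
  have : [set: nat] #<= D.
    apply/infiniteP => Dfin; apply: (omega1_uncountable W).
    rewrite -(setvU (\bigcup_(s in S) range s)); apply: countable_setU.
      exact: finite_set_countable.
    apply: bigcup_countable => // s _.
    by apply: card_le_trans (card_image_le _ _) _.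
  move=> /pcard_leP/injfunPex[g gD ginj]; exists g => _; split.
    by move=> a b; apply: ginj; rewrite inE.
  by move=> n s m Ss gs; apply: (gD n) => //; rewrite gs; exists s.
have /choice[G0 G0P] := fresh.
have [h hE] := wf_rec_image G0 (omega1_wf W).
have hc x : countable (h @` [set y | lt y x]).
  by apply: sub_countable (omega1_segment W x); exact: card_image_le.
have hinj x : injective (h x) by rewrite hE; have [] := G0P _ (hc x).
have hlt x y n m : lt y x -> h x n <> h y m.
  move=> yx; rewrite (hE x); have [_ ] := G0P _ (hc x); apply.
  by exists y.
have h2 x y n m : h x n = h y m -> x = y /\ n = m.
  move=> hxy; case: (omega1_total W x y) => [xy|xy|yx].
  - by case: (hlt _ _ m n xy).
  - by subst y; split=> //; exact: hinj hxy.
  - by case: (hlt _ _ n m yx).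
have /choice[f fP] : forall x, exists f : U -> nat, {in G x &, injective f}.
  by move=> x; exact/countable_injP.
have /choice[idx idxP] : forall u, exists x, (\bigcup_x G x) u -> G x u.
  move=> u; have [[x _ Gxu]|] := pselect ((\bigcup_x G x) u); first by exists x.
  by exists point.
apply: (@inj_card_le_im _ _ _ _ (fun u => h (idx u) (f (idx u) u))) => //.
move=> u v; rewrite !inE => Gu Gv /h2[iE].
have := idxP _ Gv; rewrite -iE => Gv'; apply: fP; rewrite inE //.
exact: idxP.
Qed.

(** A union of aleph_1 many sets of size at most aleph_1: index the parts and
    their elements by I, and cut the union into the countable sets of
    elements whose two indices both lie below z. *)
Lemma card_le_bigcup (I : pointedType) (lt : I -> I -> Prop)
    (J U : Type) (D : set J) (B : J -> set U) :
  omega1_order lt -> D #<= [set: I] -> (forall j, D j -> B j #<= [set: I]) ->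
  \bigcup_(j in D) B j #<= [set: I].
Proof.
move=> W /pcard_injP[k kinj] BI.
have /choice[f fP] : forall j, exists f : U -> I,
    D j -> {in B j &, injective f}.
  move=> j; have [Dj|] := pselect (D j); last by exists (fun=> point).
  by have /pcard_injP[f fi] := BI _ Dj; exists f.
pose G z := \bigcup_(j in [set j | D j /\ lt (k j) z])
  [set u | B j u /\ lt (f j u) z].
apply: (@card_le_trans _ _ _ (\bigcup_z G z)).
  apply: subset_card_le => u [j Dj Bju].
  have [|z zP] := @omega1_bounded _ _ [set k j; f j u] W.
    by apply: finite_set_countable; exact: finite_set2.
  by exists z => //; exists j; split=> //; apply: zP; [left|right].
apply: card_le_countable_bigcup (W) _ => z; apply: bigcup_countable.
  apply: sub_countable (omega1_segment W z).
  apply: (@inj_card_le_im _ _ _ _ k).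
    by move=> a b; rewrite !inE => -[Da _] [Db _]; apply: kinj; rewrite inE.
  by move=> x [].
move=> j [Dj _]; apply: sub_countable (omega1_segment W z).
apply: (@inj_card_le_im _ _ _ _ (f j)).
  by move=> a b; rewrite !inE => -[Da _] [Db _]; apply: fP; rewrite ?inE.
by move=> x [].
Qed.

Lemma countable_card_le_omega1 (I : Type) (lt : I -> I -> Prop)
    (U : Type) (E : set U) :
  omega1_order lt -> countable E -> E #<= [set: I].
Proof.
move=> W Ec; apply: card_le_trans Ec _; apply/infiniteP => Ifin.
exact/(omega1_uncountable W)/finite_set_countable.
Qed.

Lemma card_le_omega1_setU (I : pointedType) (lt : I -> I -> Prop)
    (U : Type) (X Y : set U) :
  omega1_order lt -> X #<= [set: I] -> Y #<= [set: I] -> X `|` Y #<= [set: I].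
Proof.
move=> W XI YI; rewrite -bigcup2inE; apply: (card_le_bigcup W).
  exact: (countable_card_le_omega1 W).
by move=> [|[|]] /=.
Qed.

(** * Closing off an aleph_0-ideal subalgebra *)

(** By recursion build an increasing chain of members h x of the family, h x
    containing h y and Phi (h y) for all y < x. The condition that Phi X is not
    contained in X makes the chain strictly increasing, so that its cofinality
    is omega_1 and its union is in the family. A countable part of the
    union is contained in one stage. *)
Lemma closing_off (disp : Order.disp_t) (B : ctbDistrLatticeType disp)
    (I : pointedType) (lt : I -> I -> Prop) (X0 : set B)
    (Phi : set B -> set B) :
  omega1_order lt -> has_card_aleph1 [set: I] -> has_card_aleph1 X0 ->
  aleph1_aleph0_ideal B ->
  (forall X, X #<= [set: I] -> Phi X #<= [set: I] /\ ~ Phi X `<=` X) ->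
  exists A, [/\ aleph0_ideal A, A #<= [set: I] &
    forall E, countable E -> E `<=` A ->
      exists X, [/\ X #<= [set: I], E `<=` X, X `<=` A & Phi X `<=` A]].
Proof.
move=> W [Iunc Imin] [X0unc X0min] [F [Fid Fcov Fchain]] PhiP.
have FI A : F A -> A #<= [set: I] by move=> /Fid[_ [_]]; exact.
have cover (S : set B) : exists A, S #<= [set: I] -> F A /\ S `<=` A.
  have [SI|] := pselect (S #<= [set: I]); last by exists set0.
  have [|A FA SA] := Fcov (S `|` X0).
    split.
      move=> Sc; apply: X0unc.
      by apply: sub_countable Sc; exact: subset_card_le.
    move=> U D Dunc; apply: card_le_trans (Imin _ _ Dunc).
    by apply: (card_le_omega1_setU W SI); exact: X0min.
  by exists A => _; split=> // x Sx; apply: SA; left.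
have [cov covP] := choice cover.
pose G (S : set (set B)) := cov (\bigcup_(Y in S) (Y `|` Phi Y)).
have [h hE] := wf_rec_image G (omega1_wf W).
have hP x : F (h x) /\ forall y, lt y x -> h y `|` Phi (h y) `<=` h x.
  elim/(well_founded_ind (omega1_wf W)): x => x IH.
  have [|Fhx hx] := covP (\bigcup_(Y in h @` [set y | lt y x]) (Y `|` Phi Y)).
    apply: (card_le_bigcup W).
      apply: (countable_card_le_omega1 W).
      by apply: sub_countable (omega1_segment W x); exact: card_image_le.
    move=> _ [y yx <-].
    have hyI : h y #<= [set: I] by apply: FI; case: (IH _ yx).
    by apply: (card_le_omega1_setU W hyI); case: (PhiP _ hyI).
  by rewrite hE; split=> // y yx z hz; apply: hx; exists (h y).
have Fh x : F (h x) by case: (hP x).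
have hmono x y : lt x y -> h x `<=` h y.
  by move=> xy z hz; have [_ /(_ _ xy)] := hP y; apply; left.
have hPhi x y : lt x y -> Phi (h x) `<=` h y.
  by move=> xy z hz; have [_ /(_ _ xy)] := hP y; apply; right.
have hstrict x y : lt x y -> ~ h y `<=` h x.
  move=> xy yx; have [_] := PhiP _ (FI _ (Fh x)); apply.
  exact: subset_trans (hPhi _ _ xy) yx.
have above (E : set B) : countable E -> E `<=` \bigcup_(Y in range h) Y ->
    exists z, E `<=` h z.
  move=> Ec EA; have /choice[ix ixP] : forall e, exists x, E e -> h x e.
    move=> e; have [/EA[_ [x _ <-] hxe]|] := pselect (E e); first by exists x.
    by exists point.
  have [|z zP] := @omega1_bounded _ _ (ix @` E) W.
    by apply: sub_countable Ec; exact: card_image_le.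
  exists z => e Ee; apply: hmono (ixP _ Ee).
  by apply: zP; exists e.
have next x : exists y, lt x y.
  have [|y yP] := @omega1_bounded _ _ [set x] W; first exact: countable1.
  by exists y; exact: yP.
(* A countable set of stages is bounded by a stage that it cannot dominate. *)
have cofinal_unc E : cofinal_in subset (range h) E -> ~ countable E.
  move=> [Eh Ecof] Ec.
  have /choice[ix ixP] : forall Y, exists x, E Y -> h x = Y.
    move=> Y; have [/Eh[x _ <-]|] := pselect (E Y); first by exists x.
    by exists point.
  have [|z zP] := @omega1_bounded _ _ (ix @` E) W.
    by apply: sub_countable Ec; exact: card_image_le.
  have [|Y EY hzY] := Ecof (h z); first by exists z.
  apply: (hstrict (ix Y) z _); first by apply: zP; exists Y.
  by rewrite ixP.
have FA : F (\bigcup_(Y in range h) Y).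
  apply: Fchain.
  - by move=> _ [x _ <-].
  - move=> _ _ [x _ <-] [y _ <-].
    case: (omega1_total W x y) => [xy|->|yx]; first by left; exact: hmono.
    + by left.
    + by right; exact: hmono.
  - have hcof : cofinal_in subset (range h) (range h).
      by split=> // Y hY; exists Y.
    have hI : range h #<= [set: I] by exact: card_image_le.
    exists (range h); split=> //.
      split; first exact: cofinal_unc.
      by move=> U D Dunc; apply: card_le_trans hI _; exact: Imin.
    by move=> E /cofinal_unc Eunc; apply: card_le_trans hI _; exact: Imin.
exists (\bigcup_(Y in range h) Y); split.
- by case: (Fid _ FA).
- exact: FI.
- move=> E Ec EA; have [z Ehz] := above _ Ec EA; have [z' zz'] := next z.
  exists (h z); split=> //.
  + exact: FI.
  + by move=> x hx; exists (h z) => //; exists z.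
  + by move=> x /(hPhi _ _ zz') hx; exists (h z') => //; exists z'.
Qed.

(** * Splitting families and almost disjoint ideals *)

Definition splits (b a : set nat) : Prop :=
  infinite_set (a `&` b) /\ infinite_set (a `\` b).

Lemma fin_class0 : fin_class set0 = \bot%O. Proof. by []. Qed.

Lemma fin_class_le0 (a : set nat) : (fin_class a <= \bot)%O -> finite_set a.
Proof. by rewrite -fin_class0 fin_class_le setD0 => /asboolP. Qed.

Lemma finite_join_of0 (x : PN_fin) : finite_join_of set0 x -> x = \bot%O.
Proof.
move=> [[|y s] sS ->]; first by rewrite big_nil.
by case: (sS y); rewrite /= mem_head.
Qed.

(** The case of two empty sets in the definition of aleph_0-ideal completeness
    provides b such that no nonzero class from X is below b or disjoint
    from b. *)
Lemma splitting_family : mc_gt_aleph1 PN_fin ->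
  exists2 K : set PN_fin, has_card_aleph1 K &
    forall X : set (set nat), X #<= K ->
      exists b, forall a, X a -> infinite_set a -> splits b a.
Proof.
move=> [M [_ Mmin] [K K1 /andP[_ /negP nMK]]]; exists K => // X XK.
have /contrapT Xc : ~ ~ aleph0_ideal_complete (fin_class @` X).
  move=> /Mmin MX; apply: nMK; apply: card_le_trans MX _.
  by apply: card_le_trans XK; exact: card_image_le.
have [||||||b [_ [_ bS] [_ bT]]] := Xc set0 set0 => //.
  rewrite setU0 => /finite_join_of0 top0; apply: infinite_nat.
  by apply: fin_class_le0; rewrite -top0.
have bE : fin_class (repr b) = b by exact: reprK.
exists (repr b) => a Xa ainf; split=> afin; apply: ainf; apply: fin_class_le0.
- have [|c /finite_join_of0 -> //] := bT (fin_class a).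
  split; first by exists a.
  rewrite -bE fin_class_meet; apply/eqP.
  by rewrite -lex0 -fin_class0 fin_class_le setD0; exact/asboolP.
- have [|c /finite_join_of0 -> //] := bS (fin_class a).
  split; first by exists a.
  by rewrite -bE fin_class_le; exact/asboolP.
Qed.

Lemma finite_set_bounded (a : set nat) : finite_set a -> exists n, a `<=` `I_n.
Proof.
move=> /finite_seqP[s ->]; exists (\max_(i <- s) i).+1 => i /= si.
by rewrite ltnS; exact: (@leq_bigmax_seq _ _ xpredT id).
Qed.

(** A member of A is almost disjoint from b when, for some n, it is contained in
    the union of the complement of b and the first n numbers. For each n the
    members of A inside that union have a countable cofinal subset: the union
    itself if it is in A, and otherwise the one that A provides as an
    aleph_0-ideal subalgebra. *)
Lemma aleph0_ideal_almost_disjoint (A : set (set nat)) (b : set nat) :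
  aleph0_ideal A ->
  exists D, [/\ countable D, D `<=` A, forall d, D d -> finite_set (d `&` b)
    & forall a, A a -> finite_set (a `&` b) -> exists2 d, D d & a `<=` d].
Proof.
move=> [_ Aid]; pose c n := ~` b `|` `I_n.
have cb n d : d `<=` c n -> finite_set (d `&` b).
  move=> dc; apply: sub_finite_set (finite_II n) => x [/dc[]] //.
have /choice[D DP] : forall n, exists D, [/\ countable D, D `<=` A,
    forall d, D d -> d `<=` c n
    & forall a, A a -> a `<=` c n -> exists2 d, D d & a `<=` d].
  move=> n; have [Ac|nAc] := pselect (A (c n)); last first.
    have [D Dc [DA Dcof]] := Aid _ nAc.
    exists D; split=> //.
    + by move=> d /DA[].
    + by move=> d /DA[_]; rewrite properEset => /properW.
    + move=> a Aa ac; have [|d Dd] := Dcof a.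
        split=> //; rewrite properEset properEneq; split=> //.
        by apply/eqP => acE; apply: nAc; rewrite -acE.
      by rewrite subsetEset; exists d.
  exists [set c n]; split=> //.
  + by move=> _ ->.
  + by move=> _ ->.
  + by move=> a _ ac; exists (c n).
exists (\bigcup_n D n); split.
- by apply: bigcup_countable => // n _; case: (DP n).
- by move=> d [n _]; case: (DP n) => _ + _ _; exact.
- by move=> d [n _ Dd]; apply: (cb n); case: (DP n) => _ _ + _; exact.
- move=> a Aa /finite_set_bounded[n an]; have [_ _ _ Dn] := DP n.
  have [|d Dd ad] := Dn a Aa.
    by move=> x ax; have [bx|nbx] := pselect (b x); [right; exact: an|left].
  by exists d => //; exists n.
Qed.

(** * Ultrafilters on the natural numbers *)

Lemma beta_proper (T : Type) (v : beta T) : ProperFilter (beta_filter v).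
Proof. by case: (beta_ultra v). Qed.
#[local] Existing Instance beta_proper.

Lemma betaS (T : Type) (v : beta T) (a b : set T) :
  a `<=` b -> beta_filter v a -> beta_filter v b.
Proof. exact: filterS. Qed.

Lemma betaI (T : Type) (v : beta T) (a b : set T) :
  beta_filter v a -> beta_filter v b -> beta_filter v (a `&` b).
Proof. exact: filterI. Qed.

Lemma betaC (T : Type) (v : beta T) (a : set T) :
  beta_filter v (~` a) <-> ~ beta_filter v a.
Proof.
split=> [vC va|nva]; last by case: (in_ultra_setVsetC a (beta_ultra v)).
by have := betaI va vC; rewrite setICr; exact: filter_not_empty.
Qed.

Lemma betaU (T : Type) (v : beta T) (a b : set T) :
  beta_filter v (a `|` b) -> beta_filter v a \/ beta_filter v b.
Proof.
move=> vab; have [va|/betaC va] := pselect (beta_filter v a); first by left.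
by right; apply: betaS (betaI vab va) => x [[]].
Qed.

Lemma beta_ext (T : Type) (v w : beta T) :
  (forall a, beta_filter v a -> beta_filter w a) -> v = w.
Proof.
case: v w => [F FU] [G GU] /= FG.
have GF : G = F by have [_] := FU; apply=> //; case: GU.
by subst G; congr Beta; exact: Prop_irrelevance.
Qed.

Lemma Nstar_infinite (v : beta nat) (a : set nat) :
  Nstar v -> beta_filter v a -> infinite_set a.
Proof.
move=> vN va afin; have n1 n : ~ beta_filter v [set n].
  move=> vn; apply: vN; exists n => //.
  case: v vn {va} => G GU /= Gn; rewrite /beta_point.
  have GE : G = principal_filter n.
    have [_ mx] := principal_filter_ultra n; apply: mx.
    by move=> b /principal_filterP bn; apply: filterS Gn => _ ->.
  by subst G; congr Beta; exact: Prop_irrelevance.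
have nI n : beta_filter v (~` `I_n).
  elim: n => [|n IH]; first by apply: betaS filterT => x _ /=; rewrite ltn0.
  have /betaC vn := n1 n; apply: betaS (betaI IH vn) => x /= [xn nx] xn1.
  by apply: nx; apply/eqP; rewrite eqn_leq -ltnS xn1 leqNgt; apply/negP.
have [n an] := finite_set_bounded afin.
by have /betaC := nI n; apply; exact: betaS va.
Qed.

(** Extend the filter of the sets that contain c up to a member of the
    ideal J to an ultrafilter. *)
Lemma Nstar_avoiding (J : set (set nat)) (c : set nat) :
  (forall a, finite_set a -> J a) -> (forall a b, J a -> J b -> J (a `|` b)) ->
  (forall a b, b `<=` a -> J a -> J b) -> ~ J c ->
  exists v : beta nat,
    [/\ Nstar v, beta_filter v c & forall a, J a -> ~ beta_filter v a].
Proof.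
move=> Jfin JU JS nJc; pose G := [set e | J (c `\` e)].
have GP : ProperFilter G.
  split; first by rewrite /G /= setD0.
  split; rewrite /G /=.
  - by rewrite setDT; apply: Jfin; exact: finite_set0.
  - by move=> a b Ga Gb; rewrite /= setDIr; exact: JU.
  - by move=> a b ab; apply: JS => x [cx nbx]; split=> // /ab.
have [H [HU GH]] := ultraFilterLemma GP.
pose v := Beta HU.
have vJ a : J a -> ~ beta_filter v a.
  by move=> Ja; apply/betaC; apply: GH; apply: JS Ja => x [_ /contrapT].
exists v; split; last exact: vJ.
  move=> [n _ nv]; apply: (vJ [set n]); first exact/Jfin/finite_set1.
  by rewrite -nv; apply/principal_filterP.
by apply: GH; rewrite /G /= setDv; apply: Jfin; exact: finite_set0.
Qed.

Lemma Nstar_contains (c : set nat) : infinite_set c ->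
  exists2 v : beta nat, Nstar v & beta_filter v c.
Proof.
move=> /(@Nstar_avoiding (@finite_set nat))[] //.
- by move=> a b; rewrite finite_setU.
- by move=> a b ba; exact: sub_finite_set.
- by move=> v [vN vc _]; exists v.
Qed.

Lemma open_beta_basic (T : Type) (a : set T) : open (beta_basic a).
Proof. by exists [set a] => //; rewrite bigcup_set1. Qed.

Lemma nbhs_betaP (T : Type) (v : beta T) (V : set (beta T)) :
  nbhs v V <-> exists2 a, beta_filter v a & beta_basic a `<=` V.
Proof.
rewrite nbhsE; split=> [[_ [[D _ <-] [a Da va]] DV]|[a va aV]].
  by exists a => // w wa; apply: DV; exists a.
by exists (beta_basic a) => //; split=> //; exact: open_beta_basic.
Qed.

Lemma within_beta_continuousP (R : realType) (Y : set (beta nat))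
    (f : beta nat -> R) :
  {within Y, continuous f} <->
  forall v (P : set R), Y v -> nbhs (f v) P ->
    exists2 a, beta_filter v a & forall w, Y w -> beta_filter w a -> P (f w).
Proof.
rewrite subspace_continuousP; split=> [fc v P Yv fP|fc v Yv P fP].
  have /= := fc v Yv P fP; rewrite /= /within /= => /nbhs_betaP[a va aP].
  by exists a => // w Yw wa; exact: aP.
have [a va aP] := fc v P Yv fP.
by apply/nbhs_betaP; exists a => // w wa Yw; exact: aP.
Qed.

(** * Continuous functions on Nstar minus a point *)

Local Open Scope ring_scope.

(** In topological terms, the clopen set of the points of Nstar that contain a
    misses u, so that f is continuous on all of it, and f maps it into P. *)
Definition piece (R : realType) (u : beta nat) (f : beta nat -> R)
    (P : set R) (a : set nat) : Prop :=
  ~ beta_filter u a /\ forall v, Nstar v -> beta_filter v a -> P (f v).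

(** The point u is in the closure of the set of the other points that f maps
    into P. *)
Definition frequently (R : realType) (u : beta nat) (f : beta nat -> R)
    (P : set R) : Prop :=
  forall e, beta_filter u e ->
    exists v, [/\ Nstar v, v <> u, beta_filter v e & P (f v)].

Lemma pieceU (R : realType) (u : beta nat) (f : beta nat -> R) (P : set R)
    (a b : set nat) :
  piece u f P a -> piece u f P b -> piece u f P (a `|` b).
Proof.
move=> [ua Pa] [ub Pb]; split=> [/betaU[]//|v vN /betaU[]]; first exact: Pa.
exact: Pb.
Qed.

Lemma pieceS (R : realType) (u : beta nat) (f : beta nat -> R) (P : set R)
    (a b : set nat) :
  b `<=` a -> piece u f P a -> piece u f P b.
Proof.
move=> ba [ua Pa]; split=> [ub|v vN vb]; first exact/ua/(betaS ba).
exact/Pa/(betaS ba).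
Qed.

Lemma piece_at (R : realType) (u : beta nat) (f : beta nat -> R) (P : set R)
    (v : beta nat) :
  {within Nstar `\ u, continuous f} -> open P -> Nstar v -> v <> u ->
  P (f v) -> exists2 a, beta_filter v a & piece u f P a.
Proof.
move=> fc Po vN vu Pfv.
have [c vc uc] : exists2 c, beta_filter v c & ~ beta_filter u c.
  apply: contrapT => h; apply: vu; apply: beta_ext => c vc.
  by apply: contrapT => uc; apply: h; exists c.
have [|a va aP] := (within_beta_continuousP _ _).1 fc v P (conj vN vu).
  exact: open_nbhs_nbhs.
exists (a `&` c); first exact: betaI.
split=> [|w wN wac]; first by move=> uac; apply: uc; apply: betaS uac => x [].
apply: aP; last by apply: betaS wac => x [].
by split=> // wu; apply: uc; rewrite -wu; apply: betaS wac => x [].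
Qed.

(** This stands in for compactness of a*. If a is not such a union, then an
    ultrafilter containing a avoids the ideal of all such unions; it differs
    from u, so by continuity it contains a piece, which is in the ideal. *)
Lemma piece_split (R : realType) (u : beta nat) (f : beta nat -> R)
    (P Q : set R) (a : set nat) :
  Nstar u -> {within Nstar `\ u, continuous f} -> open P -> open Q ->
  P `|` Q = setT -> ~ beta_filter u a ->
  exists a0 a1, [/\ a = a0 `|` a1, piece u f P a0 & piece u f Q a1].
Proof.
move=> uN fc Po Qo PQ ua; apply: contrapT => na.
pose J c := exists a0 a1, [/\ c = a0 `|` a1, piece u f P a0 & piece u f Q a1].
have finP (c : set nat) (S : set R) : finite_set c -> piece u f S c.
  by move=> cf; split=> [/(Nstar_infinite uN)//|v /Nstar_infinite h /h].
have JP c : piece u f P c -> J c.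
  move=> Pc; exists c, set0; rewrite setU0; split=> //.
  exact/finP/finite_set0.
have JQ c : piece u f Q c -> J c.
  move=> Qc; exists set0, c; rewrite set0U; split=> //.
  exact/finP/finite_set0.
have JS c d : d `<=` c -> J c -> J d.
  move=> dc [a0 [a1 [cE Pa Qa]]]; exists (d `&` a0), (d `&` a1); split.
  - by rewrite -setIUr -cE; apply/esym/setIidPl.
  - by apply: pieceS Pa => x [].
  - by apply: pieceS Qa => x [].
have [||v [vN va vJ]] := @Nstar_avoiding J a _ _ JS na.
- by move=> c cf; apply/JP/finP.
- move=> c d [c0 [c1 [-> Pc Qc]]] [d0 [d1 [-> Pd Qd]]].
  exists (c0 `|` d0), (c1 `|` d1); rewrite setUACA; split=> //; exact: pieceU.
have vu : v <> u by move=> vu; apply: ua; rewrite -vu.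
have [Pfv|Qfv] : (P `|` Q) (f v) by rewrite PQ.
- by have [c vc /JP/vJ] := piece_at fc Po vN vu Pfv.
- by have [c vc /JQ/vJ] := piece_at fc Qo vN vu Qfv.
Qed.

(** Otherwise f would map some point of Nstar into both P and Q. *)
Lemma piece_almost_disjoint (R : realType) (u : beta nat) (f : beta nat -> R)
    (P Q : set R) (a b : set nat) :
  P `&` Q = set0 -> piece u f P a -> piece u f Q b -> finite_set (a `&` b).
Proof.
move=> PQ [_ Pa] [_ Qb]; apply: contrapT => /Nstar_contains[v vN vab].
have : (P `&` Q) (f v).
  by split; [apply: Pa => //|apply: Qb => //]; apply: betaS vab => x [].
by rewrite PQ.
Qed.

Lemma frequently_piece (R : realType) (u : beta nat) (f : beta nat -> R)
    (P : set R) (e : set nat) :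
  {within Nstar `\ u, continuous f} -> open P -> frequently u f P ->
  beta_filter u e ->
  exists a, [/\ a `<=` e, infinite_set a & piece u f P a].
Proof.
move=> fc Po fP ue; have [v [vN vu ve Pfv]] := fP _ ue.
have [a va Pa] := piece_at fc Po vN vu Pfv.
exists (a `&` e); split; first by move=> x [].
  exact: Nstar_infinite vN (betaI va ve).
by apply: pieceS Pa => x [].
Qed.

(** Split b into a Q'-piece b0 and a Q-piece b1. The P-pieces in A are almost
    disjoint from b1, so they are covered by a countable set D of members of A
    almost disjoint from b1. A member of D that is in u would contain an
    infinite S-piece in A; that piece would be almost disjoint from b0 and from
    b1, against the choice of b. *)
Lemma piece_countable_cover (R : realType) (u : beta nat) (f : beta nat -> R)
    (A : set (set nat)) (b : set nat) (P Q Q' S : set R) :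
  Nstar u -> {within Nstar `\ u, continuous f} -> aleph0_ideal A ->
  ~ beta_filter u b ->
  (forall a, A a -> infinite_set a -> infinite_set (a `&` b)) ->
  open Q -> open Q' -> Q' `|` Q = setT -> P `&` Q = set0 -> S `&` Q' = set0 ->
  (forall c, A c -> beta_filter u c ->
    exists a, [/\ A a, a `<=` c, infinite_set a & piece u f S a]) ->
  exists D, [/\ countable D, D `<=` A, forall d, D d -> ~ beta_filter u d
    & forall a, A a -> piece u f P a -> exists2 d, D d & a `<=` d].
Proof.
move=> uN fc Aid ub bA Qo Q'o QQ PQ SQ AS.
have [b0 [b1 [bE Q'b0 Qb1]]] := piece_split uN fc Q'o Qo QQ ub.
have [D [Dc DA Db1 Dcov]] := aleph0_ideal_almost_disjoint b1 Aid.
exists D; split=> //.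
  move=> d Dd ud; have [a [Aa ad ainf Sa]] := AS d (DA _ Dd) ud.
  apply: (bA a Aa ainf); rewrite bE setIUr finite_setU; split.
    exact: piece_almost_disjoint SQ Sa Q'b0.
  by apply: sub_finite_set (Db1 d Dd) => x [/ad].
by move=> a Aa Pa; apply: Dcov => //; exact: piece_almost_disjoint PQ Pa Qb1.
Qed.

Lemma frequentlyPn (R : realType) (u : beta nat) (f : beta nat -> R)
    (P : set R) : ~ frequently u f P ->
  exists2 e, beta_filter u e &
    forall v, Nstar v -> v <> u -> beta_filter v e -> ~ P (f v).
Proof.
move=> /existsNP[e /not_implyP[ue h]]; exists e => // v vN vu ve Pfv.
by apply: h; exists v.
Qed.

(** The limit is the upper limit of f at u. If u had a neighbourhood containing
    no other point of Nstar, any value would do. *)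
Lemma limit_at_removed_point (R : realType) (u : beta nat) (f : beta nat -> R) :
  [bounded f x | x in Nstar `\ u] ->
  (forall p q, p < q -> frequently u f [set x | x < p] ->
     ~ frequently u f [set x | q < x]) ->
  exists l, forall eps, 0 < eps -> exists2 e, beta_filter u e &
    forall v, Nstar v -> v <> u -> beta_filter v e -> `|f v - l| < eps.
Proof.
move=> fb osc; have [M M0 fM] := ex_strict_bound_gt0 fb.
have fMv v : Nstar v -> v <> u -> `|f v| < M by move=> vN vu; exact: fM.
have [fT|/frequentlyPn[e ue eT]] := pselect (frequently u f setT); last first.
  by exists 0 => eps _; exists e => // v vN vu ve; case: (eT v).
pose S := [set r | frequently u f [set x | r < x]].
have S0 : S (- M).
  move=> e /fT[v [vN vu ve _]]; exists v; split=> //=.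
  by have := fMv v vN vu; rewrite ltr_norml => /andP[].
have uT : beta_filter u setT by exact: filterT.
have SM : ubound S M.
  move=> r /(_ _ uT)[v [vN vu _ /= rv]].
  apply: ltW; apply: lt_trans rv _.
  by have := fMv v vN vu; rewrite ltr_norml => /andP[].
have Ssup : has_sup S by split; [exists (- M)|exists M].
exists (sup S) => eps eps0; have eps2 : 0 < eps / 2 by rewrite divr_gt0.
have [r Sr rl] := sup_adherent eps2 Ssup.
have [|e1 ue1 h1] := @frequentlyPn _ u f [set x | x < r - eps / 2].
  by move=> /(osc (r - eps / 2) r _); apply=> //; rewrite ltrBlDr ltrDl.
have [|e2 ue2 h2] := @frequentlyPn _ u f [set x | sup S + eps / 2 < x].
  by move=> /(ub_le_sup (proj2 Ssup)); apply/negP; rewrite -ltNge ltrDl.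
exists (e1 `&` e2); first exact: betaI.
move=> v vN vu ve.
have /negP : ~ f v < r - eps / 2 by apply: h1 => //; apply: betaS ve => x [].
have /negP : ~ sup S + eps / 2 < f v.
  by apply: h2 => //; apply: betaS ve => x [].
rewrite -!leNgt ltr_norml => h3 h4; apply/andP; split; lra.
Qed.

Lemma extension_of_limit (R : realType) (u : beta nat) (f : beta nat -> R)
    (l : R) :
  {within Nstar `\ u, continuous f} ->
  (forall eps, 0 < eps -> exists2 e, beta_filter u e &
    forall v, Nstar v -> v <> u -> beta_filter v e -> `|f v - l| < eps) ->
  exists2 g : beta nat -> R,
    {within Nstar, continuous g} & {in Nstar `\ u, f =1 g}.
Proof.
move=> fc fl; pose g v := if pselect (v = u) then l else f v.
have gu : g u = l by rewrite /g; case: pselect.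
have gE v : v <> u -> g v = f v by rewrite /g; case: pselect.
exists g; last by move=> v; rewrite inE => -[_ vu]; rewrite gE.
apply/within_beta_continuousP => v P vN gP.
have [vu|vu] := pselect (v = u).
  move: gP; rewrite vu gu => /nbhs_ballP[eps /= eps0 epsP].
  have [e ue eP] := fl _ eps0; exists e => // w wN we.
  have [->|wu] := pselect (w = u).
    by rewrite gu; apply: epsP; exact: ballxx.
  by rewrite gE //; apply: epsP; rewrite /ball /= distrC; exact: eP.
move: gP; rewrite gE // => /nbhs_interior fP.
have [|a va [ua aP]] := piece_at fc (@open_interior _ P) vN vu _.
  exact: nbhs_singleton fP.
exists a => // w wN wa; have [wu|wu] := pselect (w = u); last first.
  by rewrite gE //; apply: interior_subset; exact: aP.
by case: ua; rewrite -wu.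
Qed.

(** * Oscillation is impossible *)

(** The function Phi of the closing-off argument adds to X the two pieces into
    which a member outside u splits, the two infinite pieces inside a member
    of u, and the complement of a set outside u that meets all infinite members
    of X in an infinite set. *)
Lemma no_oscillation (R : realType) (u : beta nat) (f : beta nat -> R)
    (p q : R) :
  aleph1_aleph0_ideal (set nat) -> mc_gt_aleph1 PN_fin -> Nstar u ->
  {within Nstar `\ u, continuous f} -> p < q ->
  frequently u f [set x | x < p] -> ~ frequently u f [set x | q < x].
Proof.
move=> hideal hmc uN fc pq fp fq.
have [K K1 Ksplit] := splitting_family hmc.
have [I [lt [W I1]]] := omega1_order_exists K1.
have IK (X : set (set nat)) : X #<= [set: I] -> X #<= K.
  by move=> XI; apply: card_le_trans XI _; case: I1 => _; apply; case: K1.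
(* One of b and its complement is outside u, and both split X. *)
have half (X : set (set nat)) : exists b, X #<= [set: I] ->
    ~ beta_filter u b /\
    forall a, X a -> infinite_set a -> infinite_set (a `&` b).
  have [/IK/Ksplit[b bX]|] := pselect (X #<= [set: I]); last by exists set0.
  have [ub|ub] := pselect (beta_filter u b).
    exists (~` b) => _; split; first by move=> /betaC.
    by move=> a Xa ainf; rewrite -setDE; case: (bX a Xa ainf).
  by exists b => _; split=> // a Xa ainf; case: (bX a Xa ainf).
have [sp spP] := choice half.
pose r := (2 * p + q) / 3; pose s := (p + 2 * q) / 3.
have [pr rs sq] : [/\ p < r, r < s & s < q] by rewrite /r /s; split; lra.
have openlt x : open [set y : R | y < x] by exact: open_lt.
have opengt x : open [set y : R | x < y] by exact: open_gt.
have lt_gt x y : x < y -> [set z : R | z < y] `|` [set z | x < z] = setT.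
  move=> xy; apply/seteqP; split=> // z _ /=.
  by have [zy|yz] := ltP z y; [left|right; exact: lt_le_trans yz].
have /choice[c cP] : forall a, exists c : set nat * set nat,
    ~ beta_filter u a -> [/\ a = c.1 `|` c.2,
      piece u f [set x | x < s] c.1 & piece u f [set x | r < x] c.2].
  move=> a; have [ua|ua] := pselect (beta_filter u a); first by exists (a, a).
  have [a0 [a1 h]] := piece_split uN fc (openlt s) (opengt r) (lt_gt _ _ rs) ua.
  by exists (a0, a1).
have /choice[d dP] : forall a, exists d : set nat * set nat,
    beta_filter u a ->
      [/\ d.1 `<=` a, infinite_set d.1 & piece u f [set x | x < p] d.1] /\
      [/\ d.2 `<=` a, infinite_set d.2 & piece u f [set x | q < x] d.2].
  move=> a; have [ua|ua] := pselect (beta_filter u a); last by exists (a, a).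
  have [d1 h1] := frequently_piece fc (openlt p) fp ua.
  have [d2 h2] := frequently_piece fc (opengt q) fq ua.
  by exists (d1, d2).
pose Phi (X : set (set nat)) := \bigcup_(phi in
  [set fst \o c; snd \o c; fst \o d; snd \o d]) (phi @` X) `|` [set ~` sp X].
have X0 : has_card_aleph1 (@repr _ PN_fin @` K).
  by apply: has_card_aleph1_image K1 => x y _ _ xy; rewrite -(reprK x) xy reprK.
have [|A [Aid AI Acl]] := @closing_off _ _ I lt _ Phi W I1 X0 hideal.
  move=> X XI; split.
    apply: (card_le_omega1_setU W); last exact: (countable_card_le_omega1 W).
    apply: (card_le_bigcup W).
      apply: (countable_card_le_omega1 W); apply: finite_set_countable.
      exact: finite_set4.
    by move=> phi _; apply: card_le_trans XI; exact: card_image_le.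
  have [usp spX] := spP X XI; have uC : beta_filter u (~` sp X) by exact/betaC.
  move=> PhiX; apply: (spX (~` sp X)).
  - by apply: PhiX; right.
  - exact: Nstar_infinite uN uC.
  - by rewrite setICl; exact: finite_set0.
have Aphi a : A a -> [/\ A (c a).1, A (c a).2, A (d a).1 & A (d a).2].
  move=> Aa; have [|_ ->|X [XI aX _ PhiA]] := Acl [set a] => //.
  have h phi : [set fst \o c; snd \o c; fst \o d; snd \o d] phi -> A (phi a).
    move=> hphi; apply: PhiA; left; exists phi => //.
    by exists a => //; exact: aX.
  split.
  - by apply: (h (fst \o c)); do 3 left.
  - by apply: (h (snd \o c)); left; left; right.
  - by apply: (h (fst \o d)); left; right.
  - by apply: (h (snd \o d)); right.
have [usp spA] := spP A AI.
have disj x y : x <= y -> [set z : R | z < x] `&` [set z | y < z] = set0.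
  move=> xy; apply/seteqP; split=> // z [/= zx yz].
  by have := lt_trans yz (lt_le_trans zx xy); rewrite ltxx.
have [||||D1 [D1c D1A D1u D1cov]] := @piece_countable_cover _ u f A (sp A)
  [set x | x < s] [set x | s < x] [set x | x < q] [set x | q < x]
  uN fc Aid usp spA (opengt s) (openlt q).
- exact: lt_gt.
- exact: disj.
- by rewrite setIC; exact: disj.
- move=> a Aa ua; exists (d a).2.
  by have [_ []] := dP a ua; have [] := Aphi a Aa.
have [||||D2 [D2c D2A D2u D2cov]] := @piece_countable_cover _ u f A (sp A)
  [set x | r < x] [set x | x < r] [set x | p < x] [set x | x < p]
  uN fc Aid usp spA (openlt r) (opengt p).
- by rewrite setUC; exact: lt_gt.
- by rewrite setIC; exact: disj.
- exact: disj.
- move=> a Aa ua; exists (d a).1.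
  by have [[]] := dP a ua; have [] := Aphi a Aa.
have [[_ _ _ AU AC] _] := Aid.
(* E generates the trace of u on A; a stage X that contains E gives the
   contradiction. *)
pose E := [set ~` (x.1 `|` x.2) | x in D1 `*` D2].
have [||X [XI EX XA PhiA]] := Acl E.
- by apply: card_le_trans (card_image_le _ _) _; exact: countableX.
- by move=> _ [[x y] [/= /D1A Ax /D2A Ay] <-]; apply: AC; exact: AU.
have [uX spX] := spP X XI.
have AX : A (sp X) by rewrite -(setCK (sp X)); apply: AC; apply: PhiA; right.
have [cE c1 c2] := cP _ uX; have [Ac1 Ac2 _ _] := Aphi _ AX.
have [d1 Dd1 cd1] := D1cov _ Ac1 c1; have [d2 Dd2 cd2] := D2cov _ Ac2 c2.
apply: (spX (~` (d1 `|` d2))).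
- by apply: EX; exists (d1, d2).
- apply: Nstar_infinite uN _; apply/betaC => /betaU[].
  + exact: D1u.
  + exact: D2u.
- rewrite (_ : _ `&` _ = set0); first exact: finite_set0.
  apply/seteqP; split=> // x []; rewrite cE => nd [/cd1|/cd2] dx; apply: nd.
    by left.
  by right.
Qed.

Theorem theorem3p6 (R : realType)
    (hideal : aleph1_aleph0_ideal (set nat))
    (hmc : mc_gt_aleph1 PN_fin)
    (u : beta nat) (hu : Nstar u) :
  Cstar_embedded R (Nstar `\ u) Nstar.
Proof.
split=> [v []//|f fb fc].
have [p q pq|l fl] := limit_at_removed_point fb.
  exact: no_oscillation.
exact: extension_of_limit fc fl.
Qed.
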